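(* Let $L=L(x,g)\in\mathbf A$ be an arbitrary formal functional from $C^\infty(N)$ to $C^\infty(M)$ which is a non-linear homomorphism, and let $S(x,q)=S_L(x,q)$ be the formal function associated with $L$, i.e. $S_L(x,q)=L(x,g)\big|_{g=y^aq_a}$. Then $L$ is the pull-back by the thick morphism generated by $S$: $$L(g)=\Phi_S^*(g)\qquad\text{for all } g\in C^\infty(N)$$ (equality of formal functionals in $\mathbf A$, i.e. in every order in $g$).
   Context: **Setting.** $M$ and $N$ are smooth manifolds; one works in coordinates $x^i$ on $M$ and $y^a$ on $N$ (so $M,N$ may be regarded as coordinate domains). Repeated indices are summed. **Formal functionals.** $\mathbf A$ is the space of formal series $L(x,g)=\sum_{k\ge 0}L_k(x,g)$, $g\in C^\infty(N)$, where each $L_k(\cdot,g)$ is a smooth function on $M$ and has order $k$ in $g$, in the sense that $L_k(x,g)=\int L(x,y_1,\dots,y_k)g(y_1)\cdots g(y_k)\,dy_1\cdots dy_k$, where the kernel may be a generalised function (so $L_k$ is the restriction to the diagonal of a symmetric $k$-linear form in $g$; $L_0$ is a smooth function of $x$ independent of $g$). $L_k$ is also written $[L]_k$; $\mathbf A_k$ is the subspace of functionals of order $k$. **Formal maps.** A formal map is a series $y^a(x,g)=K_0^a(x)+K_1^a(x,g)+K_2^a(x,g)+\dots$, where $K_0=(K_0^a)$ is a smooth map $M\to N$ and $K_r^a(x,g)$ is smooth in $x$ and of order $r$ in $g$, in the sense that $K_r^a(x,g)=\int K_r^a(x,y_1,\dots,y_r)g(y_1)\cdots g(y_r)\,dy_1\cdots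 dy_r$, where the kernel may be a generalised function. For a smooth function $h$ on $N$, $h(y(x,g))$ is understood through Taylor expansion of $h$ at $K_0(x)$, collecting terms by order in $g$. **Non-linear homomorphism.** $L\in\mathbf A$ is a non-linear homomorphism if there is a formal map $y^a(x,g)=K_0^a(x)+K_1^a(x,g)+\dots$ such that for all $g,h\in C^\infty(N)$, $L(x,g+\varepsilon h)-L(x,g)=\varepsilon\,h(y(x,g))$ with $\varepsilon^2=0$ (identity in every order in $g$). **Associated formal function.** For $L\in\mathbf A$, $S_L(x,q)=L(x,g)|_{g=y^aq_a}=S_0(x)+\sum_{k\ge1}S_k^{a_1\dots a_k}(x)q_{a_1}\cdots q_{a_k}$, a formal power series in $q$ obtained by evaluating $L$ on the linear functions $g(y)=y^aq_a$, with $S_0=L_0$ and $S_k^{a_1\dots a_k}(x)=L_k^{\rm polaris.}(x,y^{a_1},\dots,y^{a_k})$, where $L_k^{\rm polaris.}$ is the symmetric $k$-linear form with $L_k(x,g)=L_k^{\rm polaris.}(x,g,\dots,g)$ and $y^a$ are the coordinate functions on $N$. **Thick morphism and pull-back.** Given a formal power series $S(x,q)=S_0(x)+S_1^a(x)q_a+S_2^{ab}(x)q_aq_b+\dots$ with smooth coefficients (symmetric in upper indices; $x\mapsto S_1(x)=(S_1^a(x))$ a map $M\to N$), the thick morphism $\Phi_S\colon M\Rrightarrow N$ is defined by its pull-back $\Phi_S^*$, the formal functional in $\mathbf A$ given by $$\Phi_S^*(g)(x)=g(y)+S(x,q)-y^aq_a,\qquad y^a=\frac{\partial S(x,q)}{\partial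 q_a},\quad q_a=\frac{\partial g(y)}{\partial y^a},$$ where the last two equations are solved as formal series in $g$: $y^a=y^a(x,g)=y_0^a(x)+y_1^a(x,g)+\dots$ with $y_0^a(x)=S_1^a(x)$ and each $y_{k+1}^a$ determined recursively from $y_0,\dots,y_k$ by comparing terms of order $k+1$ in $g$. *)

(* Defs.v *)
(* M and N are coordinate domains: open sets U of R^m and V
   of R^n.  An element of C^oo(V) is represented by a total function on R^n that
   is smooth at the points of V, and functionals are only evaluated on such
   functions.  The domination clause of [distribution_on] forces a functional
   given by a kernel to depend only on the restriction of its argument to V. *)
From HB Require Import structures.
From mathcomp Require Import all_boot all_order all_fingroup all_algebra.
From mathcomp Require Import all_classical all_reals all_analysis.

Set Implicit Arguments.
Unset Strict Implicit.
Unset Printing Implicit Defensive.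

Import Order.TTheory GRing.Theory Num.Theory.
Import numFieldNormedType.Exports.

Local Open Scope classical_set_scope.
Local Open Scope ring_scope.

Section Smooth.
Context {R : realType} {p n : nat}.
Implicit Types (f : 'M[R]_(p, n) -> R) (vs : seq 'M[R]_(p, n)).

Definition iter_derive vs f : 'M[R]_(p, n) -> R := foldr (fun v h => 'D_v h) f vs.

Definition smooth_on (A : set 'M[R]_(p, n)) f : Prop :=
  forall vs X, A X -> differentiable (iter_derive vs f) X.

(* A compactly supported generalised function on the open set A, i.e. a
   continuous linear form on C^oo(A): it is dominated by finitely many of the
   seminorms f |-> sup_C |d_{v_1} .. d_{v_l} f|, C a compact subset of A. *)
Definition distribution_on (A : set 'M[R]_(p, n))
    (T : ('M[R]_(p, n) -> R) -> R) : Prop :=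
  (forall (c : R) f h, smooth_on A f -> smooth_on A h ->
     T (c *: f + h) = c * T f + T h) /\
  exists (C : set 'M[R]_(p, n)) (D : seq (seq 'M[R]_(p, n))) (c : R),
    [/\ compact C, C `<=` A, 0 <= c &
        forall f (B : R), smooth_on A f -> 0 <= B ->
          (forall vs X, vs \in D -> C X -> `|iter_derive vs f X| <= B) ->
          `|T f| <= c * B].

End Smooth.

(* iterated partial derivative d_{a_1} .. d_{a_k} g on R^n *)
Definition pderive {R : realType} {n : nat} (a : seq 'I_n) (g : 'rV[R]_n -> R) :
    'rV[R]_n -> R :=
  iter_derive [seq delta_mx 0 i | i <- a] g.

Definition coordinate {R : realType} {n : nat} (a : 'I_n) : 'rV[R]_n -> R :=
  fun y => y 0 a.

Section Functionals.
Context {R : realType} {m n : nat}.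
Variables (U : set 'rV[R]_m) (V : set 'rV[R]_n).
Local Notation func := ('rV[R]_n -> R).

(* The points of V^k are the k x n matrices whose rows lie in V, and the kernel
   of F at x is a generalised function T on V^k, which is paired with
   g(y_1) .. g(y_k).  As g is an arbitrary smooth function, T must have compact
   support. *)
Definition of_order (k : nat) (F : 'rV[R]_m -> func -> R) : Prop :=
  (forall g, smooth_on V g -> smooth_on U (F^~ g)) /\
  forall x, U x ->
    exists2 T : ('M[R]_(k, n) -> R) -> R,
      distribution_on [set Y | forall i, V (row i Y)] T &
      forall g, smooth_on V g -> F x g = T (fun Y => \prod_i g (row i Y)).

Definition formal_functional (L : nat -> 'rV[R]_m -> func -> R) : Prop :=
  forall k, of_order k (L k).

(* [y 0 x g] does not depend on g, being of order 0 *)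
Definition formal_map (y : nat -> 'rV[R]_m -> func -> 'rV[R]_n) : Prop :=
  (forall k a, of_order k (fun x g => y k x g 0 a)) /\
  (forall x g, U x -> smooth_on V g -> V (y 0%N x g)).

Definition symmetric_multilinear (k : nat) (P : ('I_k -> func) -> R) : Prop :=
  (forall (s : {perm 'I_k}) h, (forall i, smooth_on V (h i)) -> P (h \o s) = P h) /\
  (forall (i : 'I_k) h (c : R) (u v : func), (forall j, smooth_on V (h j)) ->
     smooth_on V u -> smooth_on V v ->
     let at_i w := P (fun j => if j == i then w else h j) in
     at_i (c *: u + v) = c * at_i u + at_i v).

(* the symmetric k-linear form whose restriction to the diagonal is F *)
Definition polarisation (k : nat) (F : func -> R) : ('I_k -> func) -> R :=
  get [set P | symmetric_multilinear P /\
               forall g, smooth_on V g -> F g = P (fun=> g)].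

(* S_k^{a_1 .. a_k}(x) is [assoc_function L [:: a_1; ..; a_k] x], the coefficient
   of q_{a_1} .. q_{a_k} in L(x, y^a q_a) *)
Definition assoc_function (L : nat -> 'rV[R]_m -> func -> R) (a : seq 'I_n)
    (x : 'rV[R]_m) : R :=
  polarisation (L (size a) x)
    (fun i : 'I_(size a) => coordinate (tnth (in_tuple a) i)).

Definition generating_function (S : seq 'I_n -> 'rV[R]_m -> R) : Prop :=
  [/\ forall a, smooth_on U (S a),
      forall a b x, U x -> perm_eq a b -> S a x = S b x &
      forall x, U x -> V (\row_a S [:: a] x)].

End Functionals.

(* For fixed x and g, a formal series in g is the sequence of its terms, indexed
   by their order in g.  Products are computed in {poly R}, where 'X marks the
   order and all series are truncated above the order that is extracted. *)
Section FormalSeries.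
Context {R : realType} {n : nat}.
Implicit Types (u y : nat -> 'rV[R]_n) (g h : 'rV[R]_n -> R).

(* term of order r of sum_k c^{a_1 .. a_k} u_{a_1} .. u_{a_k}, where u 0 = 0 (so
   that only k <= r contribute) *)
Definition eval_series (c : seq 'I_n -> R) u (r : nat) : R :=
  (\sum_(k < r.+1) \sum_(a : k.-tuple 'I_n)
     c a *: \prod_(b <- a) \poly_(j < r.+1) u j 0 b)`_r.

(* the Taylor expansion of h(y) at y_0, for a function h not depending on g *)
Definition taylor_subst h y : nat -> R :=
  eval_series (fun a => (size a)`!%:R^-1 * pderive a h (y 0%N))
              (fun j => if j is 0 then 0 else y j).

(* the terms of the series t multiplied by one more factor of order 1 *)
Definition raise_order (t : nat -> R) (r : nat) : R :=
  if r is k.+1 then t k else 0.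

(* F(g + e h) = F(g) + e c for e^2 = 0, where F is polynomial in the sense that
   it is the restriction to the diagonal of a multilinear form *)
Definition dual_expansion (F : ('rV[R]_n -> R) -> R) g h (c : R) : Prop :=
  exists2 p : {poly R},
    forall e : R, F (g + e *: h) = p.[e] &
    p %% 'X^2 = (F g)%:P + c *: 'X.

End FormalSeries.

(* The increment e h(y(x,g)) of L carries the factor h, of order 1: hence
   [raise_order] when it is compared with the terms L_k. *)
Definition nonlinear_homomorphism {R : realType} {m n : nat}
    (U : set 'rV[R]_m) (V : set 'rV[R]_n)
    (L : nat -> 'rV[R]_m -> ('rV[R]_n -> R) -> R) : Prop :=
  exists2 y : nat -> 'rV[R]_m -> ('rV[R]_n -> R) -> 'rV[R]_n,
    formal_map U V y &
    forall x g h, U x -> smooth_on V g -> smooth_on V h ->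
      forall k, dual_expansion (L k x) g h
                  (raise_order (taylor_subst h (fun j => y j x g)) k).

Section ThickMorphism.
Context {R : realType} {m n : nat}.
Variables (S : seq 'I_n -> 'rV[R]_m -> R) (x : 'rV[R]_m) (g : 'rV[R]_n -> R).
Implicit Type y : nat -> 'rV[R]_n.

(* q_a = (d_a g)(y): the factor d_a g counts as order 1 in g *)
Definition thick_momentum y (r : nat) : 'rV[R]_n :=
  \row_a raise_order (taylor_subst (pderive [:: a] g) y) r.

(* (dS/dq_a)(x, q) at the above q; as S is symmetric in its indices, dS/dq_a is
   the sum of the (k+1) S_{k+1}^{a b_1 .. b_k} q_{b_1} .. q_{b_k} *)
Definition thick_rhs y (r : nat) : 'rV[R]_n :=
  \row_a eval_series (fun b => (size b).+1%:R * S (a :: b) x)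
                     (thick_momentum y) r.

(* terms y_0, .., y_k, followed by zeros *)
Fixpoint thick_approx (k : nat) : nat -> 'rV[R]_n :=
  if k is k'.+1 then
    fun j => if j == k then thick_rhs (thick_approx k') k
             else thick_approx k' j
  else fun j => if j is 0 then \row_a S [:: a] x else 0.

Definition thick_solution (k : nat) : 'rV[R]_n := thick_approx k k.

Definition thick_pullback (r : nat) : R :=
  let y := thick_solution in
  let q := thick_momentum y in
  raise_order (taylor_subst g y) r
  + eval_series (S^~ x) q r
  - \sum_a \sum_(i < r.+1) y i 0 a * q (r - i)%N 0 a.

Lemma eval_series_loc (c : seq 'I_n -> R) (u v : nat -> 'rV[R]_n) r :
  (forall j, (j <= r)%N -> u j = v j) -> eval_series c u r = eval_series c v r.
Proof.
move=> uv; rewrite /eval_series; congr ((_ : {poly R})`_r).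
apply: eq_bigr => k _; apply: eq_bigr => a _; congr (_ *: _).
apply: eq_bigr => b _; apply/polyP => j; rewrite !coef_poly ltnS.
by case: leqP => // /uv ->.
Qed.

Lemma thick_rhs_loc (y z : nat -> 'rV[R]_n) r :
  (forall j, (j < r)%N -> y j = z j) -> thick_rhs y r = thick_rhs z r.
Proof.
move=> yz; apply/rowP => a; rewrite !mxE; apply: eval_series_loc => j jr.
apply/rowP => b; rewrite !mxE; case: j jr => //= j jr.
rewrite /taylor_subst yz ?(leq_ltn_trans _ jr)//.
by apply: eval_series_loc => -[|i] // ij; rewrite yz// (leq_ltn_trans ij).
Qed.

Lemma thick_approxE k j : (j <= k)%N -> thick_approx k j = thick_solution j.
Proof.
elim: k => [|k IH]; first by rewrite leqn0 => /eqP ->.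
rewrite leq_eqVlt => /predU1P[->//|jk] /=.
by rewrite ltn_eqF// IH.
Qed.

(* the defining equation y^a = dS/dq_a *)
Lemma thick_solutionE r : thick_solution r = thick_rhs thick_solution r.
Proof.
case: r => [|r]; last first.
  rewrite {1}/thick_solution /= eqxx; apply: thick_rhs_loc => j jr.
  exact: thick_approxE.
apply/rowP => a; rewrite !mxE /eval_series big_ord1.
rewrite (big_pred1 [tuple]) => [|t]; last exact/esym/eqP/tuple0.
by rewrite big_nil coefZ coef1 /= mulr1 mul1r.
Qed.

End ThickMorphism.

(* Main.v *)
Require Import Defs.
From mathcomp Require Import all_boot all_order all_fingroup all_algebra.
From mathcomp Require Import ring zify.
From mathcomp Require Import all_classical all_reals all_analysis.
Import Order.TTheory GRing.Theory Num.Theory.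
Import numFieldNormedType.Exports.
Local Open Scope classical_set_scope.
Local Open Scope ring_scope.

(** Fix x, let y = y(x, g) be the formal map of the homomorphism L, let
    q = dg(y), and let P(g) = g(y) + S(x, q) - y.q be the expression for the
    pull-back, evaluated on this y. The theorem follows once y is known to solve
    the equation y = dS/dq(x, q) of the thick morphism, whose solution is unique,
    and once L = P.

    Both facts are proved together, by induction on the order. The derivative of
    L at g in the direction h is h(y), which is the hypothesis on L. The
    derivative of P is h(y) + E.q', where E = dS/dq(q) - y and q' is the
    derivative of q, because the derivative of y cancels
    ([pullback_term_derive]). So the defect L - P has derivative - E.q'. If E
    vanishes in the orders below k, then in order k + 1 this derivative is
    - E_k.dh(y_0), as q starts in order 1 with dg(y_0) ([defect_derive]). It is
    zero for the directions h with dh(y_0) = 0. Hence the defect of order k + 1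
    takes the same value at g and at the linear function with differential
    dg(y_0), where it is zero, because on linear functions both L and P reduce to
    S ([defect_eq0]). As the defect of order k + 1 vanishes identically, so does
    its derivative in the direction of each coordinate function y^a, which is
    - E_k^a ([solves_all]).

    The rest makes these derivatives legitimate. Every term is a polynomial along
    lines, because a functional given by a kernel is the diagonal of a
    multilinear form ([multilinear_expand]). Polarisation makes S symmetric, with
    smooth coefficients ([polarisation_formula]). The chain rule for formal
    series ([eval_series_derive]) needs series with symmetric coefficients; for
    Taylor series this is Schwarz's theorem ([derive_comm]). *)

Set Implicit Arguments.
Unset Strict Implicit.
Unset Printing Implicit Defensive.

(** * Closure properties of smooth functions *)

Lemma near_eq_differentiable (R : realType) (W : normedModType R)
    (f g : W -> R) (x : W) :
  (\near x, f x = g x) -> differentiable f x -> differentiable g x.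
Proof.
move=> fg df; apply/diff_locallyP.
have E : g \o shift x = cst (g x) + 'd f x +o_ 0 id.
  apply/eqaddoP => e e0.
  have := diff_locally df => /eqaddoP /(_ e e0) H.
  near=> h.
  have fgx := nbhs_singleton fg.
  have -> : (g \o shift x - (cst (g x) + 'd f x)) h =
     (f \o shift x - (cst (f x) + 'd f x)) h.
    rewrite /= !fctE /= fgx; congr (_ - _).
    apply/esym; near: h.
    by have := fg; rewrite (near_shift 0) /= subr0; apply.
  by near: h.
have Hd : 'd g x = 'd f x :> (W -> R).
  by apply: diff_unique => //; exact: diff_continuous.
by rewrite Hd; split => //; exact: diff_continuous.
Unshelve. all: by end_near. Qed.

Section SmoothClosure.
Context {R : realType} {p n : nat}.
Variable A : set 'M[R]_(p, n).
Hypothesis Aopen : open A.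
Implicit Types (f g : 'M[R]_(p, n) -> R) (vs ws : seq 'M[R]_(p, n)).

Lemma open_near_eq f g X :
  (forall Y, A Y -> f Y = g Y) -> A X -> \forall Y \near X, f Y = g Y.
Proof.
move=> fg AX; near=> Y; apply: fg; near: Y.
exact: open_nbhs_nbhs.
Unshelve. all: by end_near. Qed.

Lemma iter_derive_cat vs ws f :
  iter_derive (vs ++ ws) f = iter_derive vs (iter_derive ws f).
Proof. by rewrite /iter_derive foldr_cat. Qed.

Lemma eq_iter_derive vs f g : (forall X, A X -> f X = g X) ->
  forall X, A X -> iter_derive vs f X = iter_derive vs g X.
Proof.
elim: vs f g => [//|v vs IH] f g fg X AX /=.
by apply: near_eq_derive; apply: open_near_eq => // Y AY; exact: IH.
Qed.

Lemma smooth_on_derivable f X v : smooth_on A f -> A X -> derivable f X v.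
Proof. by move=> /(_ [::] X) fs AX; apply: diff_derivable; exact: fs. Qed.

Lemma smooth_on_iter_derive vs f :
  smooth_on A f -> smooth_on A (iter_derive vs f).
Proof. by move=> fs ws X AX; rewrite -iter_derive_cat; exact: fs. Qed.

Lemma smooth_on_derive v f : smooth_on A f -> smooth_on A ('D_v f).
Proof. exact: (@smooth_on_iter_derive [:: v]). Qed.

(** Smoothness is a statement about all iterated derivatives, so it is
    proved by coinduction: it holds for the members of any class of
    differentiable functions that is stable, on A, under directional
    derivatives. A derivative needs to agree with a member of the class on A
    only, because A is open. *)
Lemma smooth_on_coind (C : ('M[R]_(p, n) -> R) -> Prop) :
  (forall f X, C f -> A X -> differentiable f X) ->
  (forall f v, C f ->
     exists2 f', C f' & forall X, A X -> 'D_v f X = f' X) ->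
  forall f, C f -> smooth_on A f.
Proof.
move=> Cdiff Cder f Cf vs; elim/last_ind: vs f Cf => [|vs v IH] f Cf X AX.
  exact: Cdiff.
rewrite -cats1 iter_derive_cat /=.
have [f' Cf' ff'] := Cder f v Cf.
have := IH _ Cf' _ AX; apply: near_eq_differentiable.
by apply: open_near_eq => // Y AY; apply/esym/eq_iter_derive.
Qed.

Lemma eq_smooth_on f g :
  (forall X, A X -> f X = g X) -> smooth_on A f -> smooth_on A g.
Proof.
move=> fg fs vs X AX; apply: near_eq_differentiable (fs vs X AX).
by apply: open_near_eq => // Y AY; exact: eq_iter_derive.
Qed.

Lemma derive_scaleD v (c : R) f g X : derivable f X v -> derivable g X v ->
  'D_v (c *: f + g) X = c * 'D_v f X + 'D_v g X.
Proof.
move=> df dg; rewrite deriveD; [|exact: derivableZ|exact: dg].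
by rewrite deriveZ.
Qed.

Lemma smooth_on_scaleD (c : R) f g :
  smooth_on A f -> smooth_on A g -> smooth_on A (c *: f + g).
Proof.
move=> fs gs.
pose C h := exists u v,
  [/\ smooth_on A u, smooth_on A v & h = c *: u + v].
apply: (@smooth_on_coind C); last by exists f, g.
- move=> _ X [u [v [us vs ->]]] AX; apply: differentiableD.
    by apply: differentiableZ; exact: (us [::]).
  exact: (vs [::]).
- move=> _ w [u [v [us vs ->]]].
  exists (c *: 'D_w u + 'D_w v).
    by exists ('D_w u), ('D_w v); split => //; exact: smooth_on_derive.
  move=> X AX; have dv := smooth_on_derivable (v := w) vs AX.
  have du := smooth_on_derivable (v := w) us AX.
  by rewrite derive_scaleD.
Qed.

Lemma iter_derive_scaleD vs (c : R) f g X :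
  smooth_on A f -> smooth_on A g -> A X ->
  iter_derive vs (c *: f + g) X = c * iter_derive vs f X + iter_derive vs g X.
Proof.
move=> fs gs; elim: vs X => [//|v vs IH] X AX /=.
have -> : 'D_v (iter_derive vs (c *: f + g)) X =
    'D_v (c *: iter_derive vs f + iter_derive vs g) X.
  by apply: near_eq_derive; apply: open_near_eq.
have df := smooth_on_derivable (v := v) (smooth_on_iter_derive vs fs) AX.
have dg := smooth_on_derivable (v := v) (smooth_on_iter_derive vs gs) AX.
by rewrite derive_scaleD.
Qed.

Lemma smooth_on_cst (c : R) : smooth_on A (cst c).
Proof.
pose C (h : 'M[R]_(p, n) -> R) := exists c, h = cst c.
apply: (@smooth_on_coind C); last by exists c.
- by move=> _ X [d ->] _; exact: differentiable_cst.
- move=> _ v [d ->]; exists (cst 0); first by exists 0.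
  by move=> X _; rewrite derive_cst.
Qed.

Lemma smooth_on0 : smooth_on A 0. Proof. exact: (smooth_on_cst 0). Qed.

Lemma smooth_onD f g : smooth_on A f -> smooth_on A g -> smooth_on A (f + g).
Proof. by move=> fs gs; rewrite -[f]scale1r; exact: smooth_on_scaleD. Qed.

Lemma smooth_onZ (c : R) f : smooth_on A f -> smooth_on A (c *: f).
Proof.
by move=> fs; rewrite -[_ *: _]addr0; exact: smooth_on_scaleD smooth_on0.
Qed.

Lemma smooth_on_sum (I : Type) (r : seq I) (P : pred I) F :
  (forall i, smooth_on A (F i)) -> smooth_on A (\sum_(i <- r | P i) F i).
Proof.
move=> Fs; elim/big_ind: _ => //; [exact: smooth_on0|exact: smooth_onD].
Qed.

(** The smallest class that contains the products of smooth functions and is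
    stable under the Leibniz rule. *)
Inductive sum_of_products : ('M[R]_(p, n) -> R) -> Prop :=
| sum_of_products_mul f g of smooth_on A f & smooth_on A g :
    sum_of_products (f * g)
| sum_of_products_add f g of sum_of_products f & sum_of_products g :
    sum_of_products (f + g).

Lemma smooth_onM f g : smooth_on A f -> smooth_on A g -> smooth_on A (f * g).
Proof.
move=> fs gs.
have Cdiff h X : sum_of_products h -> A X -> differentiable h X.
  move=> + AX; elim=> {h} [u v us vs|u v _ du _ dv].
    by apply: differentiableM; [exact: (us [::])|exact: (vs [::])].
  exact: differentiableD.
apply: (smooth_on_coind (C := sum_of_products)) => //; last exact: sum_of_products_mul.
move=> h w; elim=> {h} [u v us vs|u v Cu [u' Cu' uu'] Cv [v' Cv' vv']].
  exists (u * 'D_w v + 'D_w u * v).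
    apply: sum_of_products_add; apply: sum_of_products_mul => //;
      exact: smooth_on_derive.
  move=> X AX; have du := smooth_on_derivable (v := w) us AX.
  have dv := smooth_on_derivable (v := w) vs AX.
  rewrite deriveM; [|exact: du|exact: dv].
  by congr (_ + _); rewrite mulrC.
exists (u' + v'); first exact: sum_of_products_add.
by move=> X AX; rewrite deriveD ?uu' ?vv'//; apply: diff_derivable; exact: Cdiff.
Qed.

Lemma smooth_on_prod (I : Type) (r : seq I) F :
  (forall i, smooth_on A (F i)) -> smooth_on A (\prod_(i <- r) F i).
Proof.
by move=> Fs; elim/big_ind: _ => //; [exact: smooth_on_cst|exact: smooth_onM].
Qed.

End SmoothClosure.

Section Coordinates.
Context {R : realType} {n : nat}.

Lemma derive_coordinate (a : 'I_n) (v X : 'rV[R]_n) :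
  'D_v (coordinate a) X = v 0 a.
Proof.
have @f : {linear 'rV[R]_n -> R}.
  by exists (coordinate a); do 2![eexists]; do ?[constructor];
     rewrite /coordinate ?mxE// => ? *; rewrite ?mxE//; move=> ?; rewrite !mxE.
have fc : continuous f by exact: coord_continuous.
rewrite (_ : coordinate a = f) // deriveE; last exact: linear_differentiable.
by rewrite diff_lin.
Qed.

Lemma smooth_on_coordinate (V : set 'rV[R]_n) (a : 'I_n) :
  open V -> smooth_on V (coordinate a).
Proof.
move=> Vo; pose C (h : 'rV[R]_n -> R) := h = coordinate a \/ exists c, h = cst c.
apply: (@smooth_on_coind _ _ _ _ Vo C); last by left.
- by move=> _ X [->|[c ->]] _; [exact: differentiable_coord|exact: differentiable_cst].
- move=> _ v [->|[c ->]].
    exists (cst (v 0 a)); first by right; exists (v 0 a).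
    by move=> X _; rewrite derive_coordinate.
  by exists (cst 0); [right; exists 0|move=> X _; rewrite derive_cst].
Qed.

Lemma derive_comp_row k (g : 'rV[R]_n -> R) (i : 'I_k) (Y W : 'M[R]_(k, n)) :
  'D_W (g \o row i) Y = 'D_(row i W) g (row i Y).
Proof.
rewrite /derive; set F := (X in lim (X @ _)); set G := (X in _ = lim (X @ _)).
suff -> : F = G by [].
apply/funext => h; rewrite /F /G /=; congr (_ *: (g _ - _)).
by apply/rowP => j; rewrite !mxE.
Qed.

Lemma row_continuous k (i : 'I_k) : continuous (row i : 'M[R]_(k, n) -> 'rV[R]_n).
Proof.
move=> Y B /nbhs_ballP[e e0 eB]; apply/nbhs_ballP; exists e => // Z [_ YZ].
by apply: eB; split => // j a; rewrite !mxE; exact: YZ.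
Qed.

Lemma open_rows (V : set 'rV[R]_n) k : open V ->
  open [set Y : 'M[R]_(k, n) | forall i, V (row i Y)].
Proof.
move=> Vo.
rewrite openE => Y VY.
have VY' i : \forall Z \near Y, V (row i Z).
  have Vi : nbhs (row i Y) V by apply: open_nbhs_nbhs; split => //; exact: VY.
  exact: (@row_continuous _ i Y _ Vi).
have := filter_forall _ VY'; exact.
Qed.

Lemma smooth_on_comp_row (V : set 'rV[R]_n) k (g : 'rV[R]_n -> R) (i : 'I_k) :
  open V -> smooth_on V g ->
  smooth_on [set Y : 'M[R]_(k, n) | forall i, V (row i Y)] (g \o row i).
Proof.
move=> Vo gs.
pose C h := exists2 u : 'rV[R]_n -> R, smooth_on V u & h = u \o row i :> ('M[R]_(k, n) -> R).
apply: (smooth_on_coind (open_rows (k := k) Vo) (C := C)); last by exists g.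
- move=> _ X [u us ->] AX; apply: differentiable_comp; last exact: (us [::]).
  apply: linear_differentiable; exact: row_continuous.
- move=> _ w [u us ->]; exists ('D_(row i w) u \o row i).
    by exists ('D_(row i w) u) => //; exact: smooth_on_derive.
  by move=> X AX; rewrite derive_comp_row.
Qed.

End Coordinates.

(** * Equality of mixed derivatives *)

Section Schwarz.
Context {R : realType} {W : normedModType R}.
Implicit Types (f : W -> R) (X v w : W).

(** This reduces directional derivatives to derivatives of functions of one
    real variable, to which the mean value theorem applies. *)
Lemma is_derive_along f Z v (s : R) : derivable f (s *: v + Z) v ->
  is_derive s 1 (fun s => f (s *: v + Z)) ('D_v f (s *: v + Z)).
Proof.
have E : (fun h : R => h^-1 *: (((fun s => f (s *: v + Z)) \o shift s) (h *: 1) -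
        f (s *: v + Z))) =
      (fun h : R => h^-1 *: ((f \o shift (s *: v + Z)) (h *: v) - f (s *: v + Z))).
  apply/funext => h /=; congr (_ *: (f _ - _)).
  by rewrite addrA -scalerDl; congr (_ *: _ + _); rewrite /GRing.scale /= mulr1.
by move=> df; apply: DeriveDef; rewrite /derivable /derive E.
Qed.

Definition second_difference f X v w (t : R) : R :=
  f (t *: v + (t *: w + X)) - f (t *: v + X) - (f (t *: w + X) - f X).

Lemma second_differenceC f X v w t :
  second_difference f X v w t = second_difference f X w v t.
Proof.
by rewrite /second_difference [t *: v + (t *: w + X)]addrCA; ring.
Qed.

(** The quotient of the second difference by t ^ 2 tends to the mixed
    derivative: the mean value theorem along v turns the second difference into
    t times an increment of 'D_v f along t w, and the differentiability of
    'D_v f at X gives the value of this increment up to o(t). *)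
Lemma second_difference_bound f X v w (A : set W) : open A -> A X ->
  (forall Y, A Y -> derivable f Y v) -> differentiable ('D_v f) X ->
  forall e : R, 0 < e -> \forall t \near (0 : R)^'+,
    `|second_difference f X v w t - t * (t * 'D_w ('D_v f) X)|
      <= e * (t * (t * (`|v| + `|w|)) *+ 2).
Proof.
move=> Ao AX df ddf e e0.
have /nbhs_ballP[d1 /= d10 Ad] : nbhs X A by exact: open_nbhs_nbhs.
have := diff_locally ddf => /eqaddoP /(_ e e0) /nbhs_ballP[d2 /= d20 Dd].
have {}Dd h : `|h| < d2 ->
    `|'D_v f (h + X) - ('D_v f X + 'd ('D_v f) X h)| <= e * `|h|.
  by move=> hd; apply: (Dd h); rewrite -ball_normE /= sub0r normrN.
pose M := `|v| + `|w| + 1.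
have M0 : 0 < M by rewrite ltr_wpDl// addr_ge0.
near=> t.
have t0 : 0 < t by [].
have tM : t * M < Num.min d1 d2.
  rewrite -ltr_pdivlMr//; near: t; apply: nbhs_right_lt.
  by rewrite divr_gt0// lt_min d10.
(* s v + r w stays so small that X + s v + r w lies in A and in the range
   where the differential of 'D_v f approximates it up to e *)
have small s r : 0 <= s <= t -> 0 <= r <= t ->
   `|s *: v + r *: w| <= t * (`|v| + `|w|).
  move=> /andP[s0 st] /andP[r0 rt]; rewrite (le_trans (ler_normD _ _))//.
  by rewrite mulrDr !normrZ !ger0_norm// lerD// ler_wpM2r.
have tle : t * (`|v| + `|w|) < Num.min d1 d2.
  by rewrite (le_lt_trans _ tM)// ler_wpM2l ?(ltW t0)// lerDl.
have inA s r : 0 <= s <= t -> 0 <= r <= t -> A (s *: v + (r *: w + X)).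
  move=> st rt; apply: Ad; rewrite -ball_normE /= addrA opprD addrCA subrr addr0.
  by rewrite normrN (le_lt_trans (small _ _ st rt))// (lt_le_trans tle)// ge_min lexx.
have tt : 0 <= t <= t by rewrite lexx ltW.
have t00 : (0 : R) <= 0 <= t by rewrite lexx ltW.
pose G s := f (s *: v + (t *: w + X)) - f (s *: v + X).
pose dG s := 'D_v f (s *: v + (t *: w + X)) - 'D_v f (s *: v + X).
have GD s : 0 <= s <= t -> is_derive s 1 G (dG s).
  move=> st; apply: is_deriveB; apply: is_derive_along; apply: df.
    exact: inA.
  by have := inA _ _ st t00; rewrite scale0r add0r.
have [c ct] : exists2 c, c \in `]0, t[%R & G t - G 0 = dG c * (t - 0).
  apply: MVT; first exact: t0.
    by move=> s; rewrite in_itv/= => /andP[/ltW s0 /ltW st]; apply: GD; rewrite s0.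
  by apply: derivable_within_continuous => s; rewrite in_itv/= => /GD[].
rewrite subr0 /G !scale0r !add0r => Gt.
move: ct; rewrite in_itv/= => /andP[/ltW c0 /ltW ct'].
have ct : 0 <= c <= t by rewrite c0.
rewrite /second_difference {}Gt [dG c * t]mulrC -mulrBr normrM gtr0_norm//.
rewrite -mulrnAr [e * _]mulrCA ler_wpM2l ?(ltW t0)//.
have dvf : 'D_w ('D_v f) X = 'd ('D_v f) X w by rewrite deriveE.
have H1 : `|c *: v + t *: w| < d2.
  by rewrite (le_lt_trans (small _ _ ct tt))// (lt_le_trans tle)// ge_min lexx orbT.
have H2 : `|c *: v| < d2.
  have := small _ _ ct t00; rewrite scale0r addr0 => /le_lt_trans; apply.
  by rewrite (lt_le_trans tle)// ge_min lexx orbT.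
have {H1}D1 := le_trans (Dd _ H1) (ler_wpM2l (ltW e0) (small _ _ ct tt)).
have := small _ _ ct t00; rewrite scale0r addr0 => D2.
have {H2}{}D2 := le_trans (Dd _ H2) (ler_wpM2l (ltW e0) D2).
rewrite mulrnAr mulr2n; apply: le_trans (lerD D1 D2).
have dL : 'd ('D_v f) X (c *: v + t *: w) =
    'd ('D_v f) X (c *: v) + t * 'd ('D_v f) X w by rewrite linearD [X in _ + X = _]linearZ.
rewrite (le_trans _ (ler_normB _ _))// /dG [c *: v + (t *: w + X)]addrA dL dvf.
rewrite le_eqVlt; apply/orP; left; apply/eqP; congr (`|_|).
by move: ('D_v f _) ('D_v f _) ('D_v f _) ('d _ _ _) ('d _ _ _) => *; ring.
Unshelve. all: by end_near. Qed.

(** Schwarz's theorem, under the hypotheses of Young: the second difference is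
    symmetric in v and w, so both mixed derivatives are its limit. *)
Lemma derive_comm f X v w (A : set W) : open A -> A X ->
  (forall Y, A Y -> derivable f Y v) -> (forall Y, A Y -> derivable f Y w) ->
  differentiable ('D_v f) X -> differentiable ('D_w f) X ->
  'D_w ('D_v f) X = 'D_v ('D_w f) X.
Proof.
move=> Ao AX dv dw ddv ddw; apply/eqP; rewrite -subr_eq0 -normr_le0.
apply/ler_addgt0Pl => e e0; rewrite addr0.
pose M := (`|v| + `|w|) *+ 4 + 1.
have M0 : 0 < M by rewrite ltr_wpDl// mulrn_wge0// addr_ge0.
have eM : 0 < e / M by rewrite divr_gt0.
have H1 := second_difference_bound w Ao AX dv ddv eM.
have H2 := second_difference_bound v Ao AX dw ddw eM.
have [t [t0 [B1 B2]]] : exists t : R, 0 < t /\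
   (`|second_difference f X v w t - t * (t * 'D_w ('D_v f) X)|
      <= (e / M) * (t * (t * (`|v| + `|w|)) *+ 2) /\
   `|second_difference f X w v t - t * (t * 'D_v ('D_w f) X)|
      <= (e / M) * (t * (t * (`|w| + `|v|)) *+ 2)).
  suff : \forall t \near (0 : R)^'+, 0 < t /\
   (`|second_difference f X v w t - t * (t * 'D_w ('D_v f) X)|
      <= (e / M) * (t * (t * (`|v| + `|w|)) *+ 2) /\
   `|second_difference f X w v t - t * (t * 'D_v ('D_w f) X)|
      <= (e / M) * (t * (t * (`|w| + `|v|)) *+ 2)) by exact: filter_ex.
  by near=> t; split => //; split; near: t.
rewrite second_differenceC in B1.
have tt0 : 0 < t * t by rewrite mulr_gt0.
rewrite -(ler_pM2l tt0).
have := lerD B1 B2; rewrite addrC => /(le_trans (ler_normB _ _)) B.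
rewrite -(gtr0_norm tt0) -normrM.
set a := 'D_w _ _ in B *; set b := 'D_v ('D_w f) X in B *.
rewrite (_ : t * t * (a - b) = second_difference f X w v t - t * (t * b) -
  (second_difference f X w v t - t * (t * a))); last by ring.
apply: (le_trans B); rewrite (gtr0_norm tt0).
rewrite (_ : _ + _ = t * t * (e / M * ((`|v| + `|w|) *+ 4))); last by ring.
rewrite ler_wpM2l ?(ltW tt0)// -mulrA ler_piMr ?(ltW e0)// mulrC ler_pdivrMr//.
by rewrite mul1r lerDl.
Unshelve. all: by end_near. Qed.

End Schwarz.

Section IterDerivePermutation.
Context {R : realType} {p n : nat}.
Variable A : set 'M[R]_(p, n).
Hypothesis Aopen : open A.

Lemma iter_derive_swap (f : 'M[R]_(p, n) -> R) vs v w ws X :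
  smooth_on A f -> A X ->
  iter_derive (vs ++ v :: w :: ws) f X = iter_derive (vs ++ w :: v :: ws) f X.
Proof.
move=> fs AX; have gs := smooth_on_iter_derive ws fs.
have swap Y : A Y ->
    iter_derive [:: v, w & ws] f Y = iter_derive [:: w, v & ws] f Y.
  move=> AY; apply: (@derive_comm _ _ (iter_derive ws f) Y w v A Aopen AY).
  - by move=> Z AZ; exact: smooth_on_derivable gs AZ.
  - by move=> Z AZ; exact: smooth_on_derivable gs AZ.
  - exact: (gs [:: w]).
  - exact: (gs [:: v]).
rewrite (iter_derive_cat vs [:: v, w & ws]) (iter_derive_cat vs [:: w, v & ws]).
exact: (eq_iter_derive Aopen vs swap AX).
Qed.

End IterDerivePermutation.

(** * Multilinear forms and polarisation *)

(** The summand is a function of sequences, so that the equation is usable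
    under a recursion on the length. *)
Lemma big_tuple_cons (R : nmodType) (T : finType) k (F : seq T -> R) :
  \sum_(a : k.+1.-tuple T) F a = \sum_b \sum_(a : k.-tuple T) F (b :: a).
Proof.
rewrite pair_big /=.
rewrite (reindex (fun u : T * k.-tuple T => [tuple of u.1 :: u.2])) //=.
exists (fun a : k.+1.-tuple T => (thead a, [tuple of behead a])) => [[b a] _|a _].
  by congr (_, _); apply/val_inj.
by rewrite [RHS]tuple_eta; apply/val_inj.
Qed.

Section Multilinear.
Context {R : realType} {n : nat}.
Variable V : set 'rV[R]_n.
Hypothesis Vopen : open V.
Local Notation func := ('rV[R]_n -> R).

Definition multilinear k (Q : ('I_k -> func) -> R) : Prop :=
  forall (i : 'I_k) h (c : R) (u v : func), (forall j, smooth_on V (h j)) ->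
    smooth_on V u -> smooth_on V v ->
    let at_i w := Q (fun j => if j == i then w else h j) in
    at_i (c *: u + v) = c * at_i u + at_i v.

Lemma multilinear_sum k (Q : ('I_k -> func) -> R) (J : finType) (i : 'I_k) h
    (c : J -> R) (u : J -> func) :
  multilinear Q -> (forall j, smooth_on V (h j)) -> (forall j, smooth_on V (u j)) ->
  Q (fun j => if j == i then \sum_l c l *: u l else h j) =
  \sum_l c l * Q (fun j => if j == i then u l else h j).
Proof.
move=> Qml hs us; pose at_i w := Q (fun j => if j == i then w else h j).
have at0 : at_i 0 = 0.
  have := Qml i h 1 0 0 hs (smooth_on0 Vopen) (smooth_on0 Vopen) => /=.
  rewrite scaler0 addr0 mul1r -/(at_i 0) => /eqP.
  by rewrite eq_sym -subr_eq0 addrK => /eqP.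
rewrite -/(at_i _) -/(at_i).
suff : smooth_on V (\sum_l c l *: u l) /\
    at_i (\sum_l c l *: u l) = \sum_l c l * at_i (u l) by case.
elim: (index_enum J) => [|l r [IHs IH]].
  by rewrite !big_nil; split; [exact: smooth_on0|].
rewrite !big_cons -IH; split; first exact: smooth_on_scaleD.
exact: Qml.
Qed.

(** The multinomial expansion of the diagonal of a multilinear form. It serves
    three times: with J = bool it makes F(g + e h) a polynomial in e, with
    J = 'I_n it computes a functional on linear functions, and with J = 'I_k it
    gives the polarisation formula. *)
Lemma multilinear_expand k (Q : ('I_k -> func) -> R) (J : finType)
    (c : J -> R) (u : J -> func) :
  multilinear Q -> (forall j, smooth_on V (u j)) ->
  Q (fun=> \sum_l c l *: u l) =
  \sum_(a : k.-tuple J) (\prod_(l <- a) c l) * Q (fun i => u (tnth a i)).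
Proof.
move=> Qml us; pose w := \sum_l c l *: u l.
have ws : smooth_on V w by apply: smooth_on_sum => // l; exact: smooth_onZ.
(* the first arguments, listed in s, have been expanded; the remaining r ones
   are still equal to w, the default value of nth *)
have gen r (s : seq func) : (size s + r = k)%N ->
    (forall i, smooth_on V (nth w s i)) ->
    Q (fun i => nth w s i) = \sum_(a : r.-tuple J)
      (\prod_(l <- a) c l) * Q (fun i => nth w (s ++ [seq u l | l <- a]) i).
  elim: r s => [|r IH] s sk ss.
    rewrite (big_pred1 [tuple]) => [|t]; last exact/esym/eqP/tuple0.
    by rewrite big_nil mul1r cats0.
  have sk' : (size s < k)%N by rewrite -sk addnS ltnS leq_addr.
  rewrite (big_tuple_cons _ (fun a => (\prod_(l <- a) c l) *
    Q (fun i => nth w (s ++ [seq u l | l <- a]) i))).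
  pose i := Ordinal sk'.
  have -> : (fun j : 'I_k => nth w s j) = (fun j => if j == i then w else nth w s j).
    by apply/funext => j; case: eqP => // ->; rewrite nth_default.
  rewrite /w multilinear_sum// -/w; apply: eq_bigr => l _.
  have -> : (fun j : 'I_k => if j == i then u l else nth w s j) =
      (fun j : 'I_k => nth w (rcons s (u l)) j).
    apply/funext => j; rewrite nth_rcons -val_eqE /=.
    by case: ltngtP => // js; rewrite nth_default// ltnW.
  rewrite IH ?size_rcons ?addSnnS//; last first.
    by move=> j; rewrite nth_rcons; case: ifP => // _; case: ifP.
  rewrite big_distrr /=; apply: eq_bigr => a _.
  by rewrite big_cons mulrA cat_rcons.
have := gen k [::] (add0n k); rewrite (_ : (fun i : 'I_k => _) = fun=> w) => [->|].
- apply: eq_bigr => a _; congr (_ * Q _); apply/funext => i /=.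
  by rewrite (nth_map (tnth a i)) ?size_tuple// -tnth_nth.
- by move=> i; rewrite nth_nil.
- by apply/funext => i; rewrite nth_nil.
Qed.

(** A symmetric form is determined by its diagonal. Expanding the diagonal at
    the partial sums of h, the alternating sum over I kills, by
    inclusion-exclusion, each tuple of indices that misses some i; the remaining
    tuples are permutations, on which P takes the value P h. *)
Lemma polarisation_formula k (P : ('I_k -> func) -> R) (h : 'I_k -> func) :
  symmetric_multilinear V P -> (forall i, smooth_on V (h i)) ->
  P h *+ #|[pred a : k.-tuple 'I_k | [forall i, i \in a]]| =
  \sum_(I : {set 'I_k}) (-1) ^+ #|~: I| * P (fun=> \sum_(i in I) h i).
Proof.
move=> [Psym Pml] hs.
pose ind (I : {set 'I_k}) i : R := (i \in I)%:R.
under eq_bigr => I _.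
  rewrite (_ : \sum_(i in I) h i = \sum_i ind I i *: h i); last first.
    rewrite big_mkcond; apply: eq_bigr => i _; rewrite /ind.
    by case: ifP; rewrite ?scale1r ?scale0r.
  rewrite multilinear_expand// big_distrr /=.
  over.
rewrite exchange_big /=.
under eq_bigr => a _.
  under eq_bigr => I _ do rewrite mulrA.
  rewrite -big_distrl /=.
  rewrite (_ : \sum_I _ = ([forall i, i \in a])%:R); last first.
    transitivity (\prod_i (1 - (i \notin a)%:R) : R).
      rewrite bigA_distr; apply: eq_bigr => I _; rewrite /ind.
      transitivity (\prod_(i in ~: I) - ((i \notin a)%:R : R)); last first.
        rewrite [LHS]big_mkcond; apply: eq_bigr => i _; rewrite inE.
        by case: (i \in I).
      rewrite prodrN; congr (_ * _).
      have [aI|/allPn[l la /= lI]] := boolP (all (mem I) a).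
        rewrite big1_seq => [|i /andP[_ ia]]; last by have /= -> := allP aI _ ia.
        rewrite big1 // => i; rewrite inE => iI; case: (boolP (i \in a)) => // ia.
        by have := allP aI _ ia; rewrite /= (negPf iI).
      rewrite (big_rem l la) /= (negPf lI) mul0r.
      by rewrite (bigD1 l) ?inE//= la mul0r.
    have [/forallP aI|/forallPn[i ia]] := boolP [forall i, i \in a].
      by rewrite big1 // => i _; rewrite aI subr0.
    by rewrite (bigD1 i)//= ia subrr mul0r.
  over.
rewrite -sum1_card -sumrMnr big_mkcond /=; apply: eq_bigr => a _.
rewrite inE; case: forallP => [aI|_]; last by rewrite mul0r.
rewrite mul1r mulr1n.
have /tuple_uniqP a_inj : uniq a.
  apply: (leq_size_uniq (enum_uniq 'I_k)) => [i _|]; first exact: aI.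
  by rewrite size_tuple size_enum_ord.
rewrite -(Psym (perm a_inj))//.
by congr P; apply/funext => i /=; rewrite permE.
Qed.

(** Pairing the kernel with products of smooth functions of the separate
    variables extends the functional to a multilinear form. *)
Lemma of_order_multilinear m (U : set 'rV[R]_m) k F x :
  of_order U V k F -> U x ->
  exists2 Q : ('I_k -> func) -> R, multilinear Q &
    forall g, smooth_on V g -> F x g = Q (fun=> g).
Proof.
move=> [_ FT] Ux; have [T [Tlin _] FTx] := FT x Ux.
exists (fun h => T (fun Y => \prod_i h i (row i Y))) => // i h c u v hs us vs /=.
pose A := [set Y : 'M[R]_(k, n) | forall i, V (row i Y)].
have Ao : open A by exact: open_rows.
have prods (w : 'I_k -> func) : (forall j, smooth_on V (w j)) ->
    smooth_on A (fun Y => \prod_j w j (row j Y)).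
  move=> ws; rewrite (_ : (fun Y => _) = \prod_j (w j \o row j)).
    by apply: smooth_on_prod => // j; exact: smooth_on_comp_row.
  by apply/funext => Y; rewrite fct_prodE.
rewrite -Tlin.
- congr T; apply/funext => Y; rewrite (bigD1 i)//= eqxx.
  rewrite !fctE /GRing.scale /= mulrDl -mulrA; congr (_ * _ + _).
  + rewrite [RHS](bigD1 i)//= eqxx; congr (_ * _).
    by apply: eq_bigr => j /negPf ->.
  + rewrite [RHS](bigD1 i)//= eqxx; congr (_ * _).
    by apply: eq_bigr => j /negPf ->.
- by apply: (prods (fun j => if j == i then u else h j)) => j; case: eqP.
- by apply: (prods (fun j => if j == i then v else h j)) => j; case: eqP.
Qed.

Lemma symmetrisation k (Q : ('I_k -> func) -> R) : multilinear Q ->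
  exists2 P : ('I_k -> func) -> R, symmetric_multilinear V P &
    forall g, P (fun=> g) = Q (fun=> g).
Proof.
move=> Qml; exists (fun h => k`!%:R^-1 * \sum_(s : {perm 'I_k}) Q (h \o s)); last first.
  move=> g /=; rewrite (eq_bigr (fun=> Q (fun=> g))) // sumr_const.
  have -> : #|{perm 'I_k}| = k`! by exact: card_Sn.
  by rewrite -[Q _ *+ _]mulr_natl mulKf// pnatr_eq0 -lt0n fact_gt0.
split=> [s h _|i h c u v hs us vs /=].
  congr (_ * _); rewrite [RHS](reindex_inj (mulIg s)) /=; apply: eq_bigr => t _.
  by congr Q; apply/funext => i /=; rewrite permM.
have at_s w (s : {perm 'I_k}) : (fun j => if j == i then w else h j) \o s =
    fun j => if j == (s^-1)%g i then w else (h \o s) j.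
  by apply/funext => j /=; rewrite (can2_eq (permK s) (permKV s)).
pose upd w : 'I_k -> func := fun j => if j == i then w else h j.
rewrite (eq_bigr (fun s : {perm 'I_k} => c * Q (upd u \o s) + Q (upd v \o s))).
  by rewrite big_split -big_distrr /= mulrDr mulrCA.
by move=> s _; rewrite /upd !at_s Qml// => j; exact: hs.
Qed.

Lemma polarisationP m (U : set 'rV[R]_m) k F x :
  of_order U V k F -> U x ->
  symmetric_multilinear V (polarisation (k := k) V (F x)) /\
  forall g, smooth_on V g -> F x g = polarisation (k := k) V (F x) (fun=> g).
Proof.
move=> Fk Ux; have [Q Qml FQ] := of_order_multilinear Fk Ux.
have [P Psym PQ] := symmetrisation Qml.
rewrite /polarisation; set B := (X in get X).
suff : B (get B) by [].
by apply: getPex; exists P; split => // g gs; rewrite FQ// PQ.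
Qed.

End Multilinear.

(** * Functionals of finite order *)

Section OfOrder.
Context {R : realType} {m n : nat}.
Variables (U : set 'rV[R]_m) (V : set 'rV[R]_n).
Hypotheses (Uopen : open U) (Vopen : open V).
Local Notation func := ('rV[R]_n -> R).

(** This makes functionals of finite order differentiable along lines. *)
Lemma of_order_line k F x (g h : func) : of_order U V k F -> U x ->
  smooth_on V g -> smooth_on V h ->
  exists p : {poly R}, forall e : R, F x (g + e *: h) = p.[e].
Proof.
move=> Fk Ux gs hs; have [Q Qml FQ] := of_order_multilinear Vopen Fk Ux.
pose u b := if b then h else g.
have us b : smooth_on V (u b) by case: b.
exists (\sum_(a : k.-tuple bool) (\prod_(b <- a) (if b then 'X else 1)) *
          (Q (fun i => u (tnth a i)))%:P) => e.
rewrite FQ; last by rewrite addrC; exact: smooth_on_scaleD.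
have -> : g + e *: h = \sum_b (if b then e else 1) *: u b.
  by rewrite big_bool /= scale1r addrC.
rewrite (multilinear_expand Vopen)// horner_sum; apply: eq_bigr => a _.
rewrite hornerM hornerC horner_prod; congr (_ * _).
by apply: eq_bigr => -[] _; rewrite ?hornerX ?hornerC.
Qed.

Lemma of_order0 F x (g h : func) : of_order U V 0 F -> U x ->
  smooth_on V g -> smooth_on V h -> F x g = F x h.
Proof.
move=> [_ FT] Ux gs hs; have [T _ FTx] := FT x Ux.
by rewrite !FTx//; congr T; apply/funext => Y; rewrite !big_ord0.
Qed.

Variable L : nat -> 'rV[R]_m -> func -> R.
Hypothesis Lformal : formal_functional U V L.
Local Notation S := (assoc_function V L).

Lemma assoc_functionE k (a : k.-tuple 'I_n) x :
  S a x = polarisation (k := k) V (L k x) (fun i => coordinate (tnth a i)).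
Proof.
case: a => a ak; have ka := eqP ak; subst k.
by rewrite (bool_irrelevance ak (eqxx (size a))).
Qed.

Lemma assoc_function_perm a b x : U x -> perm_eq a b -> S a x = S b x.
Proof.
move=> Ux ab; have sab := perm_size ab.
have /tuple_permP[s as_] : perm_eq a (in_tuple b) by [].
rewrite (assoc_functionE (in_tuple b)) as_ assoc_functionE.
have [[Psym _] _] := polarisationP Vopen (Lformal (size b)) Ux.
rewrite -[RHS](Psym s) => [|i]; last exact: smooth_on_coordinate.
by congr (polarisation _ _); apply/funext => i; rewrite tnth_mktuple.
Qed.

Lemma assoc_function_linear k x (p : 'I_n -> R) : U x ->
  L k x (\sum_a p a *: coordinate a) =
  \sum_(a : k.-tuple 'I_n) (\prod_(b <- a) p b) * S a x.
Proof.
move=> Ux; have [[_ Pml] LP] := polarisationP Vopen (Lformal k) Ux.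
rewrite LP; last first.
  by apply: smooth_on_sum => // b; apply: smooth_onZ => //; exact: smooth_on_coordinate.
rewrite (multilinear_expand Vopen)//; last by move=> b; exact: smooth_on_coordinate.
by apply: eq_bigr => a _; rewrite assoc_functionE.
Qed.

(** The polarisation formula writes the coefficients of S as linear combinations
    of values of L at functions that do not depend on x. *)
Lemma smooth_on_assoc_function a : smooth_on U (S a).
Proof.
pose k := size a; pose h (i : 'I_k) : func := coordinate (tnth (in_tuple a) i).
have hs i : smooth_on V (h i) by exact: smooth_on_coordinate.
pose N := #|[pred b : k.-tuple 'I_k | [forall i, i \in b]]|.
have N0 : N%:R != 0 :> R.
  rewrite pnatr_eq0 -lt0n; apply/card_gt0P; exists (ord_tuple k).
  by apply/forallP => i; have := mem_enum 'I_k i; rewrite -val_ord_tuple => ->.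
pose f x := N%:R^-1 * \sum_(I : {set 'I_k}) (-1) ^+ #|~: I| * L k x (\sum_(i in I) h i).
apply: (@eq_smooth_on _ _ _ _ Uopen f).
  move=> x Ux; have [Psym LP] := polarisationP Vopen (Lformal k) Ux.
  rewrite /f (_ : S a x = polarisation (k := k) V (L k x) h) //.
  apply: (mulfI N0); rewrite mulVKf// mulr_natl (polarisation_formula Vopen)//.
  by apply: eq_bigr => I _; rewrite LP//; exact: smooth_on_sum.
rewrite (_ : f = N%:R^-1 *: \sum_(I : {set 'I_k}) (-1) ^+ #|~: I| *:
    (fun x => L k x (\sum_(i in I) h i))); last first.
  by apply/funext => x; rewrite /f /GRing.scale /= fct_sumE.
apply: smooth_onZ => //; apply: smooth_on_sum => // I; apply: smooth_onZ => //.
have [Ls _] := Lformal k; apply: Ls; exact: smooth_on_sum.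
Qed.

End OfOrder.

(** * Differentiation of formal series *)

Lemma is_derive_sumf (R : realType) (I : Type) (r : seq I) (F : I -> R -> R) dF
    (e : R) : (forall i, is_derive e 1 (F i) (dF i)) ->
  is_derive e 1 (fun t => \sum_(i <- r) F i t) (\sum_(i <- r) dF i).
Proof.
move=> FdF; rewrite -fct_sumE; elim/big_ind2: _ => //.
- exact: is_derive_cst.
- by move=> f df g dg ? ?; exact: is_deriveD.
Qed.

Lemma is_derive_mulf (R : realType) (f g : R -> R) (df dg e : R) :
  is_derive e 1 f df -> is_derive e 1 g dg ->
  is_derive e 1 (fun t => f t * g t) (df * g e + f e * dg).
Proof.
move=> fdf gdg; apply: (@is_derive_eq _ _ _ (f * g)).
by rewrite addrC /GRing.scale /= [g e * df]mulrC.
Qed.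

Lemma is_derive_addf (R : realType) (f g : R -> R) (df dg e : R) :
  is_derive e 1 f df -> is_derive e 1 g dg ->
  is_derive e 1 (fun t => f t + g t) (df + dg).
Proof. exact: is_deriveD. Qed.

Lemma is_derive_subf (R : realType) (f g : R -> R) (df dg e : R) :
  is_derive e 1 f df -> is_derive e 1 g dg ->
  is_derive e 1 (fun t => f t - g t) (df - dg).
Proof. exact: is_deriveB. Qed.

Section MultiSum.
Context {R : realType} {n : nat}.
Implicit Types (c : seq 'I_n -> R) (U : 'I_n -> {poly R}).

(** The degree-k part of a series in U, summed over all indices; the recursion
    on the first index turns the identities below into short inductions, and
    multisumE relates it to the sum over tuples. *)
Fixpoint multisum k c U : {poly R} :=
  if k is k'.+1 then \sum_b U b * multisum k' (fun a => c (b :: a)) U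
  else (c [::])%:P.

Lemma multisumE k c U :
  multisum k c U = \sum_(a : k.-tuple 'I_n) c a *: \prod_(b <- a) U b.
Proof.
elim: k c => [|k IH] c /=.
  rewrite (big_pred1 [tuple]) => [|t]; last exact/esym/eqP/tuple0.
  by rewrite big_nil alg_polyC.
rewrite (big_tuple_cons _ (fun a => c a *: \prod_(b <- a) U b)).
apply: eq_bigr => b _; rewrite IH big_distrr /=; apply: eq_bigr => a _.
by rewrite big_cons scalerAr.
Qed.

Lemma multisumZ k c U (s : R) : multisum k (fun a => s * c a) U = s *: multisum k c U.
Proof.
by rewrite !multisumE scaler_sumr; apply: eq_bigr => a _; rewrite scalerA.
Qed.

Lemma eq_multisum k c c' U :
  (forall a, size a = k -> c a = c' a) -> multisum k c U = multisum k c' U.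
Proof.
by move=> cc'; rewrite !multisumE; apply: eq_bigr => a _; rewrite cc' ?size_tuple.
Qed.

Lemma multisum_coef_loc k c U U' r :
  (forall b j, (j <= r)%N -> (U b)`_j = (U' b)`_j) ->
  forall j, (j <= r)%N -> (multisum k c U)`_j = (multisum k c U')`_j.
Proof.
move=> UU'; elim: k c => [//|k IH] c j jr /=.
rewrite !coef_sum; apply: eq_bigr => b _; rewrite !coefM; apply: eq_bigr => i _.
rewrite UU' ?(leq_trans (leq_ord i))// IH//.
by rewrite (leq_trans _ jr)// leq_subr.
Qed.

Lemma multisum_coef_small k c U j :
  (forall b, (U b)`_0 = 0) -> (j < k)%N -> (multisum k c U)`_j = 0.
Proof.
move=> U0; elim: k c j => [//|k IH] c j jk /=.
rewrite coef_sum big1// => b _; rewrite coefM big1// => -[[|i] /= ij] _.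
  by rewrite U0 mul0r.
rewrite IH ?mulr0//; case: j ij jk => [//|j] ij jk.
by rewrite subSS (leq_ltn_trans (leq_subr _ _)).
Qed.

(** In eval_series both the degree of the series and the truncation of its
    argument depend on the order r that is extracted. As u starts in order 1,
    one long enough series serves all orders at once. *)
Lemma eval_seriesE N c (u : nat -> 'rV[R]_n) U r : (r < N)%N -> u 0%N = 0 ->
  (forall b j, (j <= r)%N -> (U b)`_j = u j 0 b) ->
  eval_series c u r = (\sum_(k < N) multisum k c U)`_r.
Proof.
move=> rN u0 Uu; rewrite coef_sum -(subnKC rN) big_split_ord /=.
rewrite [X in _ = _ + X]big1 ?addr0 => [|k _]; last first.
  apply: (@multisum_coef_small (r.+1 + k)) => [b|]; last exact: leq_addr.
  by rewrite Uu// u0 mxE.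
rewrite /eval_series coef_sum; apply: eq_bigr => k _; rewrite -multisumE.
apply: (@multisum_coef_loc _ _ _ _ r) => // b j jr.
by rewrite coef_poly ltnS jr Uu.
Qed.

(** Polynomials stand for truncated formal series here, so curves of them are
    differentiated coefficient by coefficient. *)
Definition coef_derive (e : R) (P : R -> {poly R}) (dP : {poly R}) :=
  forall j, is_derive e 1 (fun t => (P t)`_j) dP`_j.

Lemma coef_derive_sum (I : Type) (r : seq I) e P (dP : I -> {poly R}) :
  (forall i, coef_derive e (P i) (dP i)) ->
  coef_derive e (fun t => \sum_(i <- r) P i t) (\sum_(i <- r) dP i).
Proof.
move=> PdP j; rewrite coef_sum; under eq_fun do rewrite coef_sum.
by apply: is_derive_sumf => i; exact: PdP.
Qed.

Lemma coef_deriveM e P dP Q dQ : coef_derive e P dP -> coef_derive e Q dQ ->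
  coef_derive e (fun t => P t * Q t) (dP * Q e + P e * dQ).
Proof.
move=> PdP QdQ j; rewrite coefD !coefM -big_split /=.
under eq_fun do rewrite coefM.
by apply: is_derive_sumf => i; apply: is_derive_mulf.
Qed.

(** Invariance under adjacent transpositions, hence under permutations: this is
    the form in which equality of mixed derivatives provides symmetry. *)
Definition swap_symmetric c :=
  forall s b b' t, c (s ++ [:: b, b' & t]) = c (s ++ [:: b', b & t]).

Lemma swap_symmetric_cons c b :
  swap_symmetric c -> swap_symmetric (fun a => c (b :: a)).
Proof. by move=> cs s x y t; exact: (cs (b :: s)). Qed.

Lemma swap_symmetric_rcons c s b t :
  swap_symmetric c -> c (s ++ rcons t b) = c (s ++ b :: t).
Proof.
move=> cs; elim: t s => [//|x t IH] s.
by rewrite rcons_cons -cat_rcons IH cat_rcons cs.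
Qed.

(** Differentiating a factor U_b singles out its index b, which the symmetry of
    c moves to the front; the k positions then contribute equally. *)
Lemma multisum_derive k e (c : R -> seq 'I_n -> R) dc (U : R -> 'I_n -> {poly R}) dU :
  swap_symmetric (c e) -> (forall a, is_derive e 1 (c^~ a) (dc a)) ->
  (forall b, coef_derive e (U^~ b) (dU b)) ->
  coef_derive e (fun t => multisum k (c t) (U t))
    (multisum k dc (U e) +
     k%:R *: \sum_b dU b * multisum k.-1 (fun a => c e (b :: a)) (U e)).
Proof.
move=> + + UdU; elim: k c dc => [|k IH] c dc cs cdc.
  rewrite scale0r addr0 => j /=.
  rewrite coefC; under eq_fun do rewrite coefC.
  by case: eqP => _; [exact: cdc|exact: is_derive_cst].
set D := (X in coef_derive _ _ X).
suff <- : \sum_b (dU b * multisum k (fun a => c e (b :: a)) (U e) +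
    U e b * (multisum k (fun a => dc (b :: a)) (U e) + k%:R *:
     \sum_b' dU b' * multisum k.-1 (fun a => c e [:: b, b' & a]) (U e))) = D.
  apply: coef_derive_sum => b; apply: coef_deriveM; first exact: UdU.
  by apply: (IH (fun t a => c t (b :: a))) => //; exact: swap_symmetric_cons.
rewrite big_split /= addrC; under eq_bigr do rewrite mulrDr.
rewrite big_split /= -addrA /D /=; congr (_ + _).
rewrite -natr1 scalerDl scale1r; congr (_ + _).
under eq_bigr do rewrite -scalerAr.
rewrite -scaler_sumr; case: k {IH D} => [|k]; first by rewrite !scale0r.
congr (_ *: _) => /=; under eq_bigr do rewrite big_distrr /=.
rewrite exchange_big /=; apply: eq_bigr => b' _; rewrite big_distrr /=.
apply: eq_bigr => b _; rewrite mulrCA; congr (_ * (_ * _)).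
by apply: eq_multisum => a _; exact: (cs [::]).
Qed.

(** The chain rule for the composition of a symmetric formal series c, which may
    depend on the parameter, with a formal series u in the order: the
    coefficients of the partial derivative of c in its b-th variable are
    (size a).+1 * c (b :: a). *)
Lemma eval_series_derive (c : R -> seq 'I_n -> R) dc
    (u : R -> nat -> 'rV[R]_n) (du : nat -> 'rV[R]_n) e r :
  swap_symmetric (c e) -> (forall a, is_derive e 1 (c^~ a) (dc a)) ->
  (forall t, u t 0%N = 0) ->
  (forall j b, is_derive e 1 (fun t => u t j 0 b) (du j 0 b)) ->
  is_derive e 1 (fun t => eval_series (c t) (u t) r)
    (eval_series dc (u e) r + \sum_b \sum_(i < r.+1) du i 0 b *
       eval_series (fun a => (size a).+1%:R * c e (b :: a)) (u e) (r - i)%N).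
Proof.
move=> cs cdc u0 udu.
pose U t b : {poly R} := \poly_(j < r.+1) u t j 0 b.
pose dU b : {poly R} := \poly_(j < r.+1) du j 0 b.
have UdU b : coef_derive e (U^~ b) (dU b).
  move=> j; rewrite coef_poly; under eq_fun do rewrite coef_poly.
  by case: ifP => _; [exact: udu|exact: is_derive_cst].
have Uu t b j : (j <= r)%N -> (U t b)`_j = u t j 0 b.
  by move=> jr; rewrite coef_poly ltnS jr.
have -> : (fun t => eval_series (c t) (u t) r) =
    (fun t => (\sum_(k < r.+2) multisum k (c t) (U t))`_r).
  by apply/funext => t; rewrite -(@eval_seriesE _ _ (u t))// => b j; exact: Uu.
set D := (X in is_derive _ _ _ X).
suff <- : (\sum_(k < r.+2) (multisum k dc (U e) +
     k%:R *: \sum_b dU b * multisum k.-1 (fun a => c e (b :: a)) (U e)))`_r = D.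
  by apply: coef_derive_sum => k; exact: multisum_derive.
rewrite big_split coefD /= -(@eval_seriesE _ _ (u e))//; last first.
  by move=> b j; exact: Uu.
rewrite /D; congr (_ + _); rewrite big_ord_recl scale0r add0r /=.
under eq_bigr do rewrite scaler_sumr.
rewrite exchange_big coef_sum /=; apply: eq_bigr => b _.
under eq_bigr do rewrite scalerAr.
rewrite -big_distrr coefM /=; apply: eq_bigr => i _.
rewrite {1}/dU coef_poly ltn_ord; congr (_ * _).
rewrite (@eval_seriesE r.+1 _ (u e) (U e)) ?ltnS ?leq_subr//; last first.
  by move=> b' j jr; apply: Uu; rewrite (leq_trans jr)// leq_subr.
congr ((_ : {poly R})`_ _); apply: eq_bigr => k _.
by rewrite /bump /= add1n -multisumZ; apply: eq_multisum => a ->.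
Qed.

End MultiSum.

(** * Differentiation of Taylor series *)

Section Taylor.
Context {R : realType} {n : nat}.
Variable V : set 'rV[R]_n.
Hypothesis Vopen : open V.
Local Notation func := ('rV[R]_n -> R).
Implicit Types (g h : func) (y : nat -> 'rV[R]_n).

Lemma eq_eval_series (c c' : seq 'I_n -> R) (u : nat -> 'rV[R]_n) r :
  (forall a, c a = c' a) -> eval_series c u r = eval_series c' u r.
Proof. by move=> cc'; congr (eval_series _ _ _); apply/funext. Qed.

Lemma eq_taylor_subst g h y r : V (y 0%N) -> (forall z, V z -> g z = h z) ->
  taylor_subst g y r = taylor_subst h y r.
Proof.
by move=> Vy gh; apply: eq_eval_series => a; rewrite /pderive (eq_iter_derive Vopen _ gh).
Qed.

Lemma pderive_scaleD a (e : R) g h z : smooth_on V g -> smooth_on V h -> V z ->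
  pderive a (g + e *: h) z = pderive a g z + e * pderive a h z.
Proof. by move=> gs hs Vz; rewrite addrC /pderive (iter_derive_scaleD Vopen)// addrC. Qed.

Lemma smooth_on_line g h (e : R) :
  smooth_on V g -> smooth_on V h -> smooth_on V (g + e *: h).
Proof. by move=> gs hs; rewrite addrC; exact: smooth_on_scaleD. Qed.

Lemma taylor_swap_symmetric g z : smooth_on V g -> V z ->
  swap_symmetric (fun a => (size a)`!%:R^-1 * pderive a g z).
Proof.
move=> gs Vz s b b' t; rewrite !size_cat /=; congr (_ * _).
by rewrite /pderive !map_cat /= (iter_derive_swap Vopen).
Qed.

(** d/dt (g + t h)(y_t) = h(y_t) + d_b (g + t h)(y_t) dy_b/dt, in every order.
    The partial derivatives of the Taylor series are the Taylor series of the
    partial derivatives. *)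
Lemma taylor_subst_derive g h (y : R -> nat -> 'rV[R]_n) (dy : nat -> 'rV[R]_n)
    z (e : R) r :
  smooth_on V g -> smooth_on V h -> V z -> (forall t, y t 0%N = z) ->
  dy 0%N = 0 -> (forall j b, is_derive e 1 (fun t => y t j 0 b) (dy j 0 b)) ->
  is_derive e 1 (fun t => taylor_subst (g + t *: h) (y t) r)
    (taylor_subst h (y e) r + \sum_b \sum_(i < r.+1) dy i 0 b *
       taylor_subst (pderive [:: b] (g + e *: h)) (y e) (r - i)%N).
Proof.
move=> gs hs Vz yz dy0 ydy.
have ges := smooth_on_line e gs hs.
rewrite /taylor_subst; under eq_fun do rewrite yz.
rewrite !yz.
pose c t a : R := (size a)`!%:R^-1 * pderive a (g + t *: h) z.
pose dc a : R := (size a)`!%:R^-1 * pderive a h z.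
pose u t j : 'rV[R]_n := if j is 0 then 0 else y t j.
have cs : swap_symmetric (c e) by exact: taylor_swap_symmetric.
have cdc a : is_derive e 1 (c^~ a) (dc a).
  rewrite (_ : c^~ a = (fun t => t * dc a + (size a)`!%:R^-1 * pderive a g z)).
    have D1 := is_derive_mulf (is_derive_id e 1) (is_derive_cst (dc a) e 1).
    have D2 := is_derive_addf D1
      (is_derive_cst ((size a)`!%:R^-1 * pderive a g z) e 1).
    refine (is_derive_eq D2 _).
    by rewrite mul1r mulr0 !addr0.
  by apply/funext => t; rewrite /c pderive_scaleD// mulrDr addrC mulrCA.
have udu j b : is_derive e 1 (fun t => u t j 0 b) (dy j 0 b).
  case: j => [|j]; last exact: ydy.
  have -> : (fun t => u t 0%N 0 b) = cst 0 by apply/funext => t; rewrite mxE.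
  by rewrite dy0 mxE; exact: is_derive_cst.
apply: is_derive_eq; first exact: (eval_series_derive (c := c) r cs cdc _ udu).
congr (_ + _); apply: eq_bigr => b _; apply: eq_bigr => i _; congr (_ * _).
apply: eq_eval_series => a; rewrite /c /= factS natrM invfM mulrA mulVKf ?pnatr_eq0//.
have := swap_symmetric_rcons [::] b a cs; rewrite /c size_rcons /= => /mulfI.
rewrite invr_eq0 pnatr_eq0 -lt0n fact_gt0 => /(_ isT) <-.
by rewrite /pderive map_rcons -cats1 iter_derive_cat.
Qed.

End Taylor.

(** * The pull-back expression and its derivative *)

Section Linear.
Context {R : realType} {n : nat}.
Local Notation func := ('rV[R]_n -> R).
Implicit Types (p : 'I_n -> R) (y : nat -> 'rV[R]_n).

Definition linear_fun p : func := \sum_a p a *: coordinate a.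

Lemma linear_funE p z : linear_fun p z = \sum_a p a * z 0 a.
Proof. by rewrite /linear_fun fct_sumE. Qed.

Lemma pderive1_linear_fun p a : pderive [:: a] (linear_fun p) = cst (p a).
Proof.
apply/funext => z; rewrite /pderive /= /linear_fun.
have cd (b : 'I_n) : derivable (@coordinate R n b) z (delta_mx 0 a).
  by apply: diff_derivable; exact: differentiable_coord.
rewrite derive_sum => [|b]; last by apply: derivableZ; exact: cd.
rewrite (bigD1 a)//= deriveZ ?derive_coordinate ?mxE ?eqxx /=; last exact: cd.
rewrite big1 ?addr0 => [|b ba]; first by rewrite /GRing.scale /= mulr1.
rewrite deriveZ ?derive_coordinate ?mxE /=; last exact: cd.
by rewrite (negPf ba) /GRing.scale /= mulr0.
Qed.

Lemma pderive_cst (a : seq 'I_n) (c : R) :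
  pderive a (cst c) = cst (if nilp a then c else 0).
Proof.
elim: a => [//|b a IH]; apply/funext => z.
by rewrite /pderive /= -/(pderive a _) IH derive_cst.
Qed.

Lemma pderive_linear_fun p (a : seq 'I_n) :
  (1 < size a)%N -> pderive a (linear_fun p) = cst 0.
Proof.
case/lastP: a => [//|a b]; rewrite size_rcons ltnS => a0.
rewrite /pderive map_rcons -cats1 iter_derive_cat.
rewrite -/(pderive [:: b] _) pderive1_linear_fun -/(pderive _ _) pderive_cst.
by case: a a0.
Qed.

Lemma eval_series_deg1 (c : seq 'I_n -> R) (u : nat -> 'rV[R]_n) r :
  (forall a, (1 < size a)%N -> c a = 0) -> u 0%N = 0 ->
  eval_series c u r = (r == 0%N)%:R * c [::] + \sum_b c [:: b] * u r 0 b.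
Proof.
move=> c0 u0; pose U b : {poly R} := \poly_(j < r.+1) u j 0 b.
rewrite (@eval_seriesE _ _ r.+2 _ _ U)//; last first.
  by move=> b j jr; rewrite coef_poly ltnS jr.
rewrite 2!big_ord_recl big1 ?addr0 => [/=|k _]; last first.
  by rewrite multisumE big1// => a _; rewrite c0 ?scale0r// size_tuple.
rewrite coefD coefC; congr (_ + _); first by case: eqP; rewrite ?mul1r ?mul0r.
rewrite coef_sum; apply: eq_bigr => b _.
by rewrite coefMC coef_poly ltnSn mulrC.
Qed.

Lemma taylor_subst0 (g : func) y : taylor_subst g y 0 = g (y 0%N).
Proof.
rewrite /taylor_subst /eval_series big_ord1.
rewrite (big_pred1 [tuple]) => [|t]; last exact/esym/eqP/tuple0.
by rewrite big_nil coefZ coef1 /= mulr1 invr1 mul1r.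
Qed.

Lemma taylor_subst_cst (c : R) y r : taylor_subst (cst c) y r = (r == 0%N)%:R * c.
Proof.
rewrite /taylor_subst eval_series_deg1//=.
  rewrite big1 ?addr0 => [|b _]; first by rewrite fact0 invr1 mul1r.
  by rewrite pderive_cst mulr0 mul0r.
by move=> a; case: a => [//|a s] _; rewrite pderive_cst mulr0.
Qed.

Lemma taylor_subst_linear p y r :
  taylor_subst (linear_fun p) y r = \sum_a p a * y r 0 a.
Proof.
rewrite /taylor_subst eval_series_deg1//=; last first.
  by move=> a a1; rewrite pderive_linear_fun ?mulr0.
rewrite fact0 invr1 !mul1r.
have pE a : 1 * pderive [:: a] (linear_fun p) (y 0%N) = p a.
  by rewrite pderive1_linear_fun mul1r.
under eq_bigr => a _ do rewrite pE.
case: r => [|r]; last by rewrite mul0r add0r.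
rewrite mul1r [pderive [::] _]/pderive /= linear_funE [X in _ + X]big1 ?addr0// => a _.
by rewrite mxE mulr0.
Qed.

(** If u consists of its order-1 term p, then the order coincides with the
    degree in p. *)
Lemma eval_series_linear (c : seq 'I_n -> R) (u : nat -> 'rV[R]_n) p r :
  (forall j b, u j 0 b = if j == 1%N then p b else 0) ->
  eval_series c u r = \sum_(a : r.-tuple 'I_n) (\prod_(b <- a) p b) * c a.
Proof.
move=> uE; rewrite (@eval_seriesE _ _ r.+1 _ _ (fun b => p b *: 'X))//; last 2 first.
- by apply/rowP => b; rewrite uE mxE.
- by move=> b j _; rewrite coefZ coefX uE; case: eqP; rewrite ?mulr1 ?mulr0.
have mE k : multisum k c (fun b => p b *: 'X) =
    (\sum_(a : k.-tuple 'I_n) (\prod_(b <- a) p b) * c a) *: 'X^k.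
  rewrite multisumE scaler_suml; apply: eq_bigr => a _.
  rewrite mulrC -scalerA; congr (_ *: _).
  rewrite -[X in 'X^X](size_tuple a).
  elim: (tval a) => [|b s IH]; first by rewrite !big_nil scale1r.
  by rewrite !big_cons IH /= exprS -scalerAl -scalerAr scalerA.
rewrite coef_sum big_ord_recr /= big1 ?add0r => [|k _].
  by rewrite mE coefZ coefXn eqxx mulr1.
by rewrite mE coefZ coefXn gtn_eqF ?mulr0.
Qed.

End Linear.

Section PullbackTerm.
Context {R : realType} {m n : nat}.
Variable V : set 'rV[R]_n.
Hypothesis Vopen : open V.
Variables (S : seq 'I_n -> 'rV[R]_m -> R) (x : 'rV[R]_m).
Local Notation func := ('rV[R]_n -> R).
Implicit Types (g h : func) (y : nat -> 'rV[R]_n).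

(** The formula for the pull-back by the thick morphism, evaluated on an
    arbitrary formal series y in place of the solution of y = dS/dq. *)
Definition pullback_term g y (r : nat) : R :=
  raise_order (taylor_subst g y) r + eval_series (S^~ x) (thick_momentum g y) r
  - \sum_a \sum_(i < r.+1) y i 0 a * thick_momentum g y (r - i)%N 0 a.

(** On g = p.y the momentum is the constant p, so the terms g(y) and y.q cancel,
    whatever y is, and S(x, p) remains. *)
Lemma pullback_term_linear p y r :
  pullback_term (linear_fun p) y r =
  \sum_(a : r.-tuple 'I_n) (\prod_(b <- a) p b) * S a x.
Proof.
have qE j b : thick_momentum (linear_fun p) y j 0 b = if j == 1%N then p b else 0.
  rewrite mxE; case: j => [//|j] /=.
  by rewrite pderive1_linear_fun taylor_subst_cst eqSS; case: eqP => _; rewrite ?mul1r ?mul0r.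
rewrite /pullback_term (eval_series_linear _ _ qE) addrAC -[RHS]add0r.
congr (_ + _); apply/eqP; rewrite subr_eq0; apply/eqP.
case: r => [|r] /=.
  by rewrite big1// => a _; rewrite big_ord1 qE mulr0.
rewrite taylor_subst_linear; apply: eq_bigr => a _.
rewrite big_ord_recr big_ord_recr /= big1 => [|i _].
  by rewrite subnn subSnn !qE/= mulr0 addr0 add0r mulrC.
have ri : (r.+1 - i)%N != 1%N by have := ltn_ord i; lia.
by rewrite qE (negPf ri) mulr0.
Qed.

Hypothesis Ssym : swap_symmetric (S^~ x).

(** The pull-back is a Legendre-type expression, stationary in y and q: as
    q = dg(y), the derivative of y cancels, and the derivative of q is
    multiplied by dS/dq(q) - y, which vanishes on the solution of the thick
    equations. The lowest term of the derivative of q is dh(y_0). *)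
Lemma pullback_term_derive g h (y : R -> nat -> 'rV[R]_n) (dy : nat -> 'rV[R]_n)
    z (e : R) :
  smooth_on V g -> smooth_on V h -> V z -> (forall t, y t 0%N = z) ->
  dy 0%N = 0 -> (forall j b, is_derive e 1 (fun t => y t j 0 b) (dy j 0 b)) ->
  exists dq : nat -> 'rV[R]_n,
    [/\ dq 0%N = 0, forall a, dq 1%N 0 a = pderive [:: a] h z &
     forall r, is_derive e 1 (fun t => pullback_term (g + t *: h) (y t) r)
       (raise_order (taylor_subst h (y e)) r + \sum_a \sum_(i < r.+1) dq i 0 a *
         (thick_rhs S x (g + e *: h) (y e) (r - i)%N 0 a - y e (r - i)%N 0 a))].
Proof.
move=> gs hs Vz yz dy0 ydy.
pose q t := thick_momentum (g + t *: h) (y t).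
pose dqf a j := taylor_subst (pderive [:: a] h) (y e) j + \sum_b \sum_(i < j.+1)
  dy i 0 b * taylor_subst (pderive [:: b] (pderive [:: a] g + e *: pderive [:: a] h))
               (y e) (j - i)%N.
pose dq j : 'rV[R]_n := \row_a raise_order (dqf a) j.
have Vy t : V (y t 0%N) by rewrite yz.
have ds f a : smooth_on V f -> smooth_on V (pderive [:: a] f).
  by move=> fs; exact: smooth_on_derive.
have qdq j b : is_derive e 1 (fun t => q t j 0 b) (dq j 0 b).
  rewrite mxE.
  case: j => [|j].
    have -> : (fun t => q t 0%N 0 b) = cst 0 by apply/funext => t; rewrite mxE.
    exact: is_derive_cst.
  have -> : (fun t => q t j.+1 0 b) =
    (fun t => taylor_subst (pderive [:: b] g + t *: pderive [:: b] h) (y t) j).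
    apply/funext => t; rewrite mxE /=; apply: (eq_taylor_subst Vopen) => // w Vw.
    exact: (pderive_scaleD Vopen).
  exact: (taylor_subst_derive Vopen j (ds _ b gs) (ds _ b hs) Vz yz dy0 ydy).
exists dq; split.
- by apply/rowP => a; rewrite !mxE.
- move=> a; rewrite mxE /= /dqf taylor_subst0 yz big1 ?addr0// => b _.
  by rewrite big_ord1 dy0 mxE mul0r.
move=> r.
have D1 : is_derive e 1 (fun t => raise_order (taylor_subst (g + t *: h) (y t)) r)
   (raise_order (taylor_subst h (y e)) r +
     \sum_b \sum_(i < r.+1) dy i 0 b * q e (r - i)%N 0 b).
  case: r => [|r] /=.
    rewrite big1 ?addr0 => [|b _]; first exact: is_derive_cst.
    by rewrite big_ord1 dy0 mxE mul0r.
  have := taylor_subst_derive Vopen r gs hs Vz yz dy0 ydy.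
  move=> H; refine (is_derive_eq H _); congr (_ + _).
  apply: eq_bigr => b _; rewrite [RHS]big_ord_recr /= subnn [in X in _ = _ + X]mxE /=.
  rewrite mulr0 addr0; apply: eq_bigr => i _; congr (_ * _).
  by rewrite mxE subSn//= -ltnS.
have q0 t : q t 0%N = 0 by apply/rowP => a; rewrite !mxE.
have D2 := eval_series_derive r (c := fun=> S^~ x) (dc := fun=> 0) Ssym
  (fun a => is_derive_cst (S a x) e 1) q0 qdq.
have D3 : is_derive e 1
    (fun t => \sum_a \sum_(i < r.+1) y t i 0 a * q t (r - i)%N 0 a)
    (\sum_a \sum_(i < r.+1)
       (dy i 0 a * q e (r - i)%N 0 a + y e i 0 a * dq (r - i)%N 0 a)).
  by apply: is_derive_sumf => a; apply: is_derive_sumf => i; exact: is_derive_mulf.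
refine (is_derive_eq (is_derive_subf (is_derive_addf D1 D2) D3) _).
rewrite /=.
have -> : eval_series (fun=> 0) (q e) r = 0.
  rewrite /eval_series big1 ?coef0// => k _; rewrite big1// => a _.
  by rewrite scale0r.
rewrite add0r -!addrA; congr (_ + _).
under [X in - X]eq_bigr do rewrite big_split /=.
rewrite big_split /= opprD [X in _ + X]addrCA addNKr -sumrB; apply: eq_bigr => a _.
rewrite [X in _ - X](reindex_inj rev_ord_inj) /= -sumrB; apply: eq_bigr => i _.
have ir : (i <= r)%N by rewrite -ltnS.
rewrite subSS (subKn ir) mulrBr; congr (_ - _); last exact: mulrC.
by congr (_ * _); rewrite mxE.
Qed.

End PullbackTerm.

(** * Homomorphisms are pull-backs by thick morphisms *)

(** The expansion at the point e of the line g + t h is a polynomial in t - e. *)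
Lemma dual_expansion_derive (R : realType) (n : nat) (F : ('rV[R]_n -> R) -> R)
    g h (e c : R) :
  dual_expansion F (g + e *: h) h c -> is_derive e 1 (fun t => F (g + t *: h)) c.
Proof.
case=> p Fp pc.
have -> : (fun t => F (g + t *: h)) = horner (p \Po ('X - e%:P)).
  apply/funext => t; rewrite horner_comp !hornerE -Fp -addrA -scalerDl.
  by rewrite [e + _]addrC subrK.
apply: (@is_derive_eq _ _ _ _ _ _ _ (p \Po ('X - e%:P))^`().[e]).
rewrite deriv_comp derivB derivX derivC subr0 mulr1 horner_comp !hornerE subrr.
rewrite (divp_eq p 'X^2) pc !derivD derivM derivXn derivC derivZ derivX !hornerE /=.
by rewrite mulr0 !add0r.
Qed.

Section Homomorphism.
Context {R : realType} {m n : nat}.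
Variables (U : set 'rV[R]_m) (V : set 'rV[R]_n).
Hypotheses (Uopen : open U) (Vopen : open V).
Local Notation func := ('rV[R]_n -> R).
Variable L : nat -> 'rV[R]_m -> func -> R.
Hypothesis Lformal : formal_functional U V L.
Local Notation S := (assoc_function V L).
Variable y : nat -> 'rV[R]_m -> func -> 'rV[R]_n.
Hypothesis yformal : formal_map U V y.
Hypothesis Lhom : forall x g h, U x -> smooth_on V g -> smooth_on V h ->
  forall k, dual_expansion (L k x) g h
              (raise_order (taylor_subst h (fun j => y j x g)) k).
Variable x : 'rV[R]_m.
Hypothesis Ux : U x.
Local Notation Y g := (fun j => y j x g).
Implicit Types g h : func.

Lemma assoc_function_swap : swap_symmetric (S^~ x).
Proof.
move=> s b b' t; apply: (assoc_function_perm Vopen Lformal Ux).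
by rewrite perm_cat2l (perm_catCA [:: b] [:: b'] t).
Qed.

(** The two sides of the theorem differ by this, with the formal map of L in
    place of the solution of the thick equations. *)
Definition defect g k : R := L k x g - pullback_term S x g (Y g) k.

Definition solves g (k : nat) : Prop := thick_rhs S x g (Y g) k = y k x g.

(** The derivative h(y) of L cancels the first term of the derivative of the
    pull-back. By the assumption on the orders j with j + 1 < k, and as q starts
    in order 1, only the product of the order-1 term of the derivative of q with
    the order k - 1 of dS/dq(q) - y remains. *)
Lemma defect_derive g h k (e : R) : smooth_on V g -> smooth_on V h ->
  (forall f j, smooth_on V f -> (j.+1 < k)%N -> solves f j) ->
  let G := g + e *: h in
  is_derive e 1 (fun t => defect (g + t *: h) k)
   (- if k is k'.+1 then \sum_a pderive [:: a] h (y 0%N x G) *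
      (thick_rhs S x G (Y G) k' 0 a - y k' x G 0 a) else 0).
Proof.
move=> gs hs IH G.
have line t : smooth_on V (g + t *: h) by exact: smooth_on_line.
have [yo yV] := yformal.
have y0E t : y 0%N x (g + t *: h) = y 0%N x G.
  by apply/rowP => a; exact: (of_order0 (yo 0%N a) Ux (line t) (line e)).
pose dy j : 'rV[R]_n := \row_a 'D_1 (fun t : R => y j x (g + t *: h) 0 a) e.
have ydy j a : is_derive e 1 (fun t => y j x (g + t *: h) 0 a) (dy j 0 a).
  rewrite mxE; apply: derivableP.
  have [p yp] := of_order_line Vopen (yo j a) Ux gs hs.
  have -> : (fun t => y j x (g + t *: h) 0 a) = horner p by exact/funext.
  exact: derivable_horner.
have dy0 : dy 0%N = 0.
  apply/rowP => a; rewrite !mxE.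
  have -> : (fun t => y 0%N x (g + t *: h) 0 a) = cst (y 0%N x G 0 a).
    by apply/funext => t; rewrite y0E.
  exact: derive_cst.
have [dq [dq0 dq1 PdP]] := pullback_term_derive Vopen assoc_function_swap
  gs hs (yV x G Ux (line e)) y0E dy0 ydy.
refine (is_derive_eq (is_derive_subf
  (dual_expansion_derive (Lhom Ux (line e) hs k)) (PdP k)) _).
rewrite -/G opprD addrA subrr add0r; congr (- _).
case: k IH => [|k] IH.
  by rewrite big1// => a _; rewrite big_ord1 dq0 mxE mul0r.
apply: eq_bigr => a _; rewrite big_ord_recl dq0 mxE mul0r add0r.
rewrite big_ord_recl big1 ?addr0 /= => [|i _].
  by rewrite /bump /= addn0 subSS subn0 dq1.
rewrite /bump /= !add1n subSS.
rewrite (IH G (k - i.+1)%N (line e)) ?subrr ?mulr0//.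
by have := ltn_ord i; lia.
Qed.

Lemma defect_linear p k : defect (linear_fun p) k = 0.
Proof. by rewrite /defect pullback_term_linear (assoc_function_linear Vopen Lformal)// subrr. Qed.

Lemma smooth_on_linear_fun p : smooth_on V (linear_fun p).
Proof.
by apply: smooth_on_sum => // a; apply: smooth_onZ => //; exact: smooth_on_coordinate.
Qed.

(** Join g to the linear function l with the same differential at y_0. The
    direction g - l has zero differential at y_0, and y_0 does not depend on the
    function, so the defect is constant on the line from l to g; it vanishes at
    l. *)
Lemma defect_eq0 k :
  (forall f j, smooth_on V f -> (j.+1 < k)%N -> solves f j) ->
  forall g, smooth_on V g -> defect g k = 0.
Proof.
move=> IH g gs; have [yo yV] := yformal.
pose z := y 0%N x g; have Vz : V z by exact: yV.
pose l := linear_fun (fun a => pderive [:: a] g z).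
have ls : smooth_on V l by exact: smooth_on_linear_fun.
pose h := g - l.
have hE : h = g + (-1) *: l by rewrite scaleN1r.
have hs : smooth_on V h by rewrite hE; exact: smooth_on_line.
have dh a : pderive [:: a] h z = 0.
  by rewrite hE (pderive_scaleD Vopen)// pderive1_linear_fun mulN1r subrr.
have <- : defect (l + 1 *: h) k = defect g k by rewrite scale1r addrC subrK.
suff -> : defect (l + 1 *: h) k = defect (l + 0 *: h) k.
  by rewrite scale0r addr0 defect_linear.
apply: (@is_derive_0_is_cst _ (fun t => defect (l + t *: h) k)) => e.
refine (is_derive_eq (defect_derive e ls hs IH) _).
case: k {IH} => [|k]; first exact: oppr0.
rewrite big1 ?oppr0// => a _.
have -> : y 0%N x (l + e *: h) = z.
  apply/rowP => b; apply: (of_order0 (yo 0%N b) Ux) => //.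
  exact: smooth_on_line.
by rewrite dh mul0r.
Qed.

(** The defect of order k + 1 vanishes on the whole line g + t y^a, and its
    derivative at g is the a-th component of y_k - (dS/dq(q))_k. *)
Lemma solves_all k g : smooth_on V g -> solves g k.
Proof.
elim/ltn_ind: k g => k IH g gs.
have IH' f j : smooth_on V f -> (j.+1 < k.+1)%N -> solves f j.
  by move=> fs jk; exact: IH.
apply/rowP => a.
have cs : smooth_on V (coordinate a) by exact: smooth_on_coordinate.
have D := defect_derive 0 gs cs IH'.
have D0 : is_derive (0 : R) 1 (fun t => defect (g + t *: coordinate a) k.+1) 0.
  have -> : (fun t => defect (g + t *: coordinate a) k.+1) = cst 0.
    apply/funext => t; apply: defect_eq0 => //; exact: smooth_on_line.
  exact: is_derive_cst.
have := @derive_val _ _ _ _ _ _ _ D; rewrite (@derive_val _ _ _ _ _ _ _ D0).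
rewrite scale0r addr0 (bigD1 a)//= big1 => [|b ba].
  rewrite addr0 /pderive /= derive_coordinate mxE !eqxx mul1r => /eqP.
  by rewrite eq_sym oppr_eq0 subr_eq0 => /eqP.
by rewrite /pderive /= derive_coordinate mxE eq_sym (negPf ba) mul0r.
Qed.

(** The thick equations determine each order of y from the lower ones. *)
Lemma thick_solution_formal_map g : smooth_on V g -> thick_solution S x g = Y g.
Proof.
move=> gs; apply/funext => k; elim/ltn_ind: k => k IH.
by rewrite thick_solutionE -(solves_all k gs); exact: thick_rhs_loc.
Qed.

Lemma homomorphism_thick_pullback g k : smooth_on V g ->
  L k x g = thick_pullback S x g k.
Proof.
move=> gs; apply/eqP; rewrite -subr_eq0.
rewrite -[thick_pullback _ _ _ _]/(pullback_term S x g (thick_solution S x g) k).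
rewrite thick_solution_formal_map//; apply/eqP; apply: defect_eq0 => //.
by move=> f j fs _; exact: solves_all.
Qed.

(** In order 0 the thick equations read S_1 = y_0. *)
Lemma assoc_function1 : V (\row_a S [:: a] x).
Proof.
have s0 := smooth_on0 Vopen; have [_ yV] := yformal.
have := yV x 0 Ux s0; rewrite -/(Y 0 0%N) -(thick_solution_formal_map s0).
by [].
Qed.

End Homomorphism.

Unset Implicit Arguments.

Theorem theorem2 (R : realType) (m n : nat)
    (U : set 'rV[R]_m) (V : set 'rV[R]_n)
    (L : nat -> 'rV[R]_m -> ('rV[R]_n -> R) -> R) :
  open U -> open V ->
  formal_functional U V L ->
  nonlinear_homomorphism U V L ->
  generating_function U V (assoc_function V L) /\
  forall g x, smooth_on V g -> U x ->
    forall k, L k x g = thick_pullback (assoc_function V L) x g k.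
Proof.
move=> Uo Vo Lf [y yf Lh]; split.
  split.
  - by move=> a; exact: smooth_on_assoc_function.
  - by move=> a b x Ux; exact: (assoc_function_perm Vo Lf).
  - by move=> x Ux; exact: (assoc_function1 Vo Lf yf Lh).
by move=> g x gs Ux k; exact: (homomorphism_thick_pullback Vo Lf yf Lh).
Qed.
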